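(* Let $f:\mathbb{R}^n\to\overline{\mathbb{R}}$ be a proper closed convex function with $S=\operatorname{argmin}_{x\in\mathbb{R}^n}f(x)\neq\emptyset$ and $f^\star=\min_x f(x)$. Suppose that for every $x^\star\in S$ there are a constant $\mu_{\mathrm q}>0$ and a neighborhood $\mathcal U\subseteq\mathbb{R}^n$ containing $x^\star$ such that $$\frac{\mu_{\mathrm q}}{2}\,\mathrm{dist}^2(x,S)\le f(x)-f^\star\qquad\forall x\in\mathcal U.$$ Let $\{c_k\}_{k\ge0}$ be a positive sequence bounded away from zero, and let $\{x_k\}_{k\ge0}$ be any sequence satisfying, for all $k\ge 0$, both $$\|x_{k+1}-\mathrm{prox}_{c_kf}(x_k)\|\le\epsilon_k,\quad \sum_{k=0}^\infty\epsilon_k<\infty,$$ and $$\|x_{k+1}-\mathrm{prox}_{c_kf}(x_k)\|\le\delta_k\|x_{k+1}-x_k\|,\quad \sum_{k=0}^\infty\delta_k<\infty,$$ where $\{\epsilon_k\}$ and $\{\delta_k\}$ are nonnegative sequences. Then there exist nonnegative $\theta_k<1$ and a large $\bar k>0$ such that $$\mathrm{dist}(x_{k+1},S)\le\hat\theta_k\,\mathrm{dist}(x_k,S)\quad\forall k\ge\bar k,\qquad\text{where}\quad \hat\theta_k=\frac{\theta_k+2\delta_k}{1-\delta_k}<1.$$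
   Context: $\overline{\mathbb{R}}=\mathbb{R}\cup\{\pm\infty\}$; $\|\cdot\|$ is the Euclidean norm. $f$ is proper if $f>-\infty$ everywhere and $f(x)<\infty$ for some $x$; closed if its epigraph is closed. $\mathrm{dist}(x,S)=\min_{y\in S}\|x-y\|$. For $\alpha>0$, $\mathrm{prox}_{\alpha f}(z)=\operatorname{argmin}_{x\in\mathbb{R}^n}\{f(x)+\frac{1}{2\alpha}\|x-z\|^2\}$, which is a unique point. The constant $\mu_{\mathrm q}$ and the neighborhood $\mathcal U$ may depend on $x^\star$. The iterates $x_k$ are allowed to be infeasible, i.e. $f(x_k)=+\infty$ is possible. *)

(* Defs.v *)
From HB Require Import structures.
From mathcomp Require Import all_boot all_order all_algebra.
From mathcomp Require Import all_classical all_reals all_analysis.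
Set Implicit Arguments.
Unset Strict Implicit.
Unset Printing Implicit Defensive.
Import Order.TTheory GRing.Theory Num.Theory.
Import numFieldNormedType.Exports.
Local Open Scope classical_set_scope.
Local Open Scope ring_scope.

(* The library norm `|x| on 'rV[R]_n is the sup norm. It induces the same
   topology as the Euclidean one, so nbhs and closed are the library's, but
   every metric quantity below uses [enorm]. *)
Definition enorm (R : realType) (n : nat) (x : 'rV[R]_n) : R :=
  Num.sqrt (\sum_(i < n) x 0 i ^+ 2).

(* The infimum is the minimum whenever A is nonempty and closed; for empty A
   it takes the default value 0. *)
Definition dist (R : realType) (n : nat) (x : 'rV[R]_n) (A : set 'rV[R]_n) : R :=
  inf [set enorm (x - y) | y in A].

Section ExtendedRealValued.
Variables (R : realType) (n : nat).
Implicit Types (f : 'rV[R]_n -> \bar R).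

Definition proper_fun f : Prop :=
  (forall x, (-oo < f x)%E) /\ (exists x, (f x < +oo)%E).

Definition epigraph f : set ('rV[R]_n * R) :=
  [set p | (f p.1 <= p.2%:E)%E].

Definition closed_fun f : Prop := closed (epigraph f).

(* Intended for f > -oo, where the sum is never of the form +oo - oo; at
   t = 0 and t = 1 the convention 0 * +oo = 0 makes the inequality trivial. *)
Definition convex_fun f : Prop :=
  forall (x y : 'rV[R]_n) (t : R), 0 <= t <= 1 ->
    (f (t *: x + (1 - t) *: y)%R <= t%:E * f x + (1 - t)%:E * f y)%E.

Definition argmin f : set 'rV[R]_n := [set x | forall y, (f x <= f y)%E].

(* The infimum is the minimum whenever [argmin f] is nonempty. *)
Definition minval f : \bar R := ereal_inf (range f).

(* [get] selects the element of the argmin, which is a singleton for f proper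
   closed convex and alpha > 0. *)
Definition prox (alpha : R) f (z : 'rV[R]_n) : 'rV[R]_n :=
  get (argmin (fun x => (f x + ((2 * alpha)^-1 * enorm (x - z) ^+ 2)%:E)%E)).

End ExtendedRealValued.

(* Main.v *)
Require Import Defs.
From HB Require Import structures.
From mathcomp Require Import all_boot all_order all_algebra.
From mathcomp Require Import all_classical all_reals all_analysis.
From mathcomp Require Import ring lra.
Set Implicit Arguments.
Unset Strict Implicit.
Unset Printing Implicit Defensive.
Import Order.TTheory GRing.Theory Num.Theory.
Import numFieldNormedType.Exports.
Local Open Scope classical_set_scope.
Local Open Scope ring_scope.

(** The proximal map contracts the distance to the solution set [S] as soon as
    its value lies where the quadratic growth holds. Let [p] be the proximal
    point of [z] with parameter [alpha]. Strong convexity of the proximal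
    objective gives, for every [s] in [S],
<<
      2 alpha (f p - f s) + |p - z|^2 + |p - s|^2 <= |z - s|^2
>>
    ([prox_decrease]). Dropping terms shows that [p] is at most as far from
    each minimizer as [z] is ([prox_fejer]) and that [|p - z| <= dist z S]
    ([prox_displacement]). Bounding [f p - f s] from below by the growth
    condition shows that the distance shrinks by the factor
    [1 / sqrt (1 + mu alpha)] ([prox_dist_contraction]).

    The growth condition is local and its constant depends on the minimizer, so
    the iterates must be shown to settle near a single one
    ([inexact_prox_cvg]). By the Fejer inequality, [|x_k - s|] increases by
    at most [eps_k] at step [k], and a nonnegative sequence with summable
    increases has increments tending to zero. In [prox_decrease] this forces
    [f p_k] to the minimal value, so a cluster point [xinf] of the bounded
    sequence [p_k] is a minimizer because sublevel sets are closed. The same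
    quasi-monotonicity, now applied to [|x_k - xinf|], upgrades the cluster
    point to a limit.

    With [mu] the growth constant at [xinf] and [c0] a lower bound of the
    [c_k], the constant [theta = 1 / sqrt (1 + mu c0)] serves at all large [k].
    The relative error costs at most [delta_k / (1 - delta_k)] times
    [dist x_k S], because [(1 - delta_k) |x_{k+1} - x_k|] is at most
    [|p_k - x_k|]. *)

(** * Euclidean norm and distance to a set *)

Section Euclidean.
Variables (R : realType) (n : nat).
Implicit Types (x y z : 'rV[R]_n) (A : set 'rV[R]_n).

Definition dot x y : R := \sum_(i < n) x 0 i * y 0 i.

Lemma enorm_ge0 x : 0 <= enorm x.
Proof. exact: sqrtr_ge0. Qed.

Lemma sqr_enorm x : enorm x ^+ 2 = \sum_(i < n) x 0 i ^+ 2.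
Proof. by rewrite sqr_sqrtr// sumr_ge0// => i _; exact: sqr_ge0. Qed.

Lemma enormN x : enorm (- x) = enorm x.
Proof. by congr Num.sqrt; apply: eq_bigr => i _; rewrite mxE sqrrN. Qed.

Lemma enorm_distC x y : enorm (x - y) = enorm (y - x).
Proof. by rewrite -enormN opprB. Qed.

Lemma enorm0 : enorm (0 : 'rV[R]_n) = 0.
Proof. by rewrite /enorm big1 ?sqrtr0// => i _; rewrite mxE expr0n. Qed.

(** The library norm on row vectors is the sup norm; this comparison transfers
    Euclidean estimates to its neighborhoods and bounded sets. *)
Lemma norm_le_enorm x : `|x| <= enorm x.
Proof.
rewrite [`|x|]mx_normrE; apply/bigmax_leP; split => [|[i j] _ /=].
  exact: enorm_ge0.
rewrite (ord1 i) -sqrtr_sqr ler_wsqrtr// (bigD1 j)//= lerDl sumr_ge0//.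
by move=> k _; exact: sqr_ge0.
Qed.

Lemma sqr_enormD x y :
  enorm (x + y) ^+ 2 = enorm x ^+ 2 + enorm y ^+ 2 + 2 * dot x y.
Proof.
rewrite !sqr_enorm /dot mulr_sumr -!big_split/=.
by apply: eq_bigr => i _; rewrite mxE; ring.
Qed.

(** Cauchy-Schwarz, from the nonnegativity of the squared norm of
    [enorm x *: y - enorm y *: x]. *)
Lemma dot_le_enorm x y : dot x y <= enorm x * enorm y.
Proof.
have [x0|x0] := eqVneq (enorm x) 0.
  rewrite x0 mul0r /dot big1// => i _.
  suff -> : x = 0 by rewrite mxE mul0r.
  by apply/eqP; rewrite -normr_le0 (le_trans (norm_le_enorm x))// x0.
have [y0|y0] := eqVneq (enorm y) 0.
  rewrite y0 mulr0 /dot big1// => i _.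
  suff -> : y = 0 by rewrite mxE mulr0.
  by apply/eqP; rewrite -normr_le0 (le_trans (norm_le_enorm y))// y0.
have xy0 : 0 < enorm x * enorm y by rewrite mulr_gt0// lt_def ?x0 ?y0 enorm_ge0.
rewrite -(ler_pM2l xy0) -subr_ge0.
have : 0 <= \sum_(i < n) (enorm x * y 0 i - enorm y * x 0 i) ^+ 2.
  by apply: sumr_ge0 => i _; exact: sqr_ge0.
under eq_bigr => i _.
  rewrite (_ : _ ^+ 2 = enorm x ^+ 2 * y 0 i ^+ 2 + enorm y ^+ 2 * x 0 i ^+ 2
    - 2 * (enorm x * enorm y) * (x 0 i * y 0 i)); last ring.
  over.
rewrite sumrB big_split/= -!mulr_sumr -!sqr_enorm -/(dot x y).
nra.
Qed.

Lemma enormD x y : enorm (x + y) <= enorm x + enorm y.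
Proof.
rewrite -ler_sqr ?nnegrE ?addr_ge0 ?enorm_ge0// sqr_enormD sqrrD.
by have := dot_le_enorm x y; nra.
Qed.

Lemma enorm_triangle z x y : enorm (x - y) <= enorm (x - z) + enorm (z - y).
Proof. by have := enormD (x - z) (z - y); rewrite subrKA. Qed.

(** The exact defect of convexity of the squared norm: its last term is what
    makes the proximal objective strongly convex. *)
Lemma sqr_enorm_convex_comb (t : R) x y :
  enorm (t *: x + (1 - t) *: y) ^+ 2 =
  t * enorm x ^+ 2 + (1 - t) * enorm y ^+ 2 - t * (1 - t) * enorm (x - y) ^+ 2.
Proof.
rewrite !sqr_enorm !mulr_sumr -big_split -sumrB/=.
by apply: eq_bigr => i _; rewrite !mxE; ring.
Qed.

Lemma enorm_continuous : continuous (@enorm R n).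
Proof.
move=> x; apply: continuous_comp; last exact: sqrt_continuous.
apply: continuous_big => [|i _ {}x].
  exact: add_continuous.
apply: (@continuous_comp _ _ _ (fun y : 'rV[R]_n => y 0 i) (fun t => t ^+ 2)).
  exact: coord_continuous.
exact: exprn_continuous.
Qed.

Lemma enormB_continuous z : continuous (fun x => enorm (x - z)).
Proof.
move=> x; apply: (@continuous_comp _ _ _ (fun x => x - z) (@enorm R n)).
  by apply: continuousB; [exact: cvg_id|exact: cst_continuous].
exact: enorm_continuous.
Qed.

Lemma compact_enorm_ball z (r : R) : compact [set x | enorm (x - z) <= r].
Proof.
apply: bounded_closed_compact.
  exists (r + `|z|); split; first exact: num_real.
  move=> M rM x /= xr; apply: (le_trans _ (ltW rM)).
  by rewrite -lerBlDr (le_trans (lerB_dist _ _))// (le_trans (norm_le_enorm _)).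
apply: (@preimage_closed _ _ (fun x => enorm (x - z)) [set t | t <= r]).
  by move=> x _; exact: enormB_continuous.
exact: closed_le.
Qed.

Lemma dist_le x y A : A y -> dist x A <= enorm (x - y).
Proof.
move=> Ay; apply: ge_inf; last by exists y.
by exists 0 => _ [w _ <-]; exact: enorm_ge0.
Qed.

Lemma le_dist (r : R) x A : A !=set0 ->
  (forall y, A y -> r <= enorm (x - y)) -> r <= dist x A.
Proof.
move=> [a Aa] h; apply: lb_le_inf; first by exists (enorm (x - a)), a.
by move=> _ [w Aw <-]; exact: h.
Qed.

Lemma dist_ge0 x A : A !=set0 -> 0 <= dist x A.
Proof. by move=> A0; apply: le_dist => // y _; exact: enorm_ge0. Qed.

Lemma dist_triangle x y A : A !=set0 -> dist x A <= enorm (x - y) + dist y A.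
Proof.
move=> A0; rewrite -lerBlDl; apply: le_dist => // w Aw.
by rewrite lerBlDl (le_trans (dist_le x Aw))// enorm_triangle.
Qed.

End Euclidean.

(** * The proximal map of a closed convex function *)

Section ProximalPoint.
Variables (R : realType) (n : nat) (f : 'rV[R]_n -> \bar R).
Hypotheses (f_proper : proper_fun f) (f_closed : closed_fun f).
Hypothesis f_convex : convex_fun f.
Implicit Types (s x y z p : 'rV[R]_n).

Lemma sublevel_closed (r : R) : closed [set x | (f x <= r%:E)%E].
Proof.
apply: (@preimage_closed _ _ (fun x => (x, r)) (epigraph f)) => // x _.
apply: (@cvg_pair _ _ _ (nbhs x) (nbhs x) (nbhs r)); first exact: cvg_id.
exact: cvg_cst.
Qed.

Lemma argmin_fin_num s : argmin f s -> f s \is a fin_num.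
Proof.
move=> sS; have [fgt [x0 fx0]] := f_proper.
by rewrite fin_numElt fgt/= (le_lt_trans (sS x0)).
Qed.

Lemma minval_argmin s : argmin f s -> minval f = f s.
Proof.
move=> sS; apply/eqP; rewrite eq_le ereal_inf_lbound/=; last by exists s.
by apply: le_ereal_inf_tmp => _ [y _ <-]; exact: sS.
Qed.

(** The proximal objective attains its minimum, so the default value of [get]
    is never used. Since [f] is only lower semicontinuous, the minimization is
    carried out over the epigraph, where the objective becomes the continuous
    function [(x, t) |-> t + k |x - z|^2]. Comparison with a minimizer [s] of
    [f] confines it to a compact slice: candidates are no farther from [z] than
    [s], and have heights between the minimum of [f] and the objective at
    [s]. *)
Lemma prox_argmin (alpha : R) z : 0 < alpha -> argmin f !=set0 ->
  argmin (fun x => f x + ((2 * alpha)^-1 * enorm (x - z) ^+ 2)%:E)%E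
    (prox alpha f z).
Proof.
move=> alpha0 [s sS]; apply: (@getPex _ (argmin _)).
have := argmin_fin_num sS; case fsE : (f s) => [m| |]// _.
have fge y : (m%:E <= f y)%E by rewrite -fsE.
have k0 : 0 < (2 * alpha)^-1 by rewrite invr_gt0 mulr_gt0.
move: k0; set k := (2 * alpha)^-1 => k0.
pose r := enorm (s - z); pose T := m + k * r ^+ 2.
pose h (q : 'rV[R]_n * R) := q.2 + k * enorm (q.1 - z) ^+ 2.
pose K := ([set x | enorm (x - z) <= r] `*` `[m, T]) `&` epigraph f.
have mT : m <= T by rewrite lerDl mulr_ge0 ?sqr_ge0// ltW.
have Ks : K (s, m).
  by split; [split => //=; rewrite in_itv/= lexx|rewrite /epigraph/= fsE].
have cK : compact K.
  apply: compact_closedI => //; apply: compact_setX; last exact: segment_compact.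
  exact: compact_enorm_ball.
have ch : {within K, continuous h}.
  apply: continuous_subspaceT => q; apply: continuousD.
    exact: cvg_snd.
  apply: continuousM; first exact: cst_continuous.
  apply: (@continuous_comp _ _ _ (fun q : 'rV[R]_n * R => enorm (q.1 - z))
    (fun t => t ^+ 2)); last exact: exprn_continuous.
  apply: (@continuous_comp _ _ _ fst (fun x => enorm (x - z))).
    exact: cvg_fst.
  exact: enormB_continuous.
have [|[p t]] := compact_EVT_min _ cK ch; first by exists (s, m).
rewrite inE => -[[/= pr /andP[mt tT]]]; rewrite /epigraph/= => fpt pmin.
exists p => y.
have hp_le u : K u -> (f p + (k * enorm (p - z) ^+ 2)%:E <= (h u)%:E)%E.
  move=> Ku; apply: (@le_trans _ _ (h (p, t))%:E).
    by rewrite /h EFinD leeD2r.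
  by rewrite lee_fin; apply: pmin; rewrite inE.
have [yT|yT] := leP (f y + (k * enorm (y - z) ^+ 2)%:E)%E T%:E; last first.
  exact: le_trans (hp_le _ Ks) (ltW yT).
move: (fge y) yT; case fyE : (f y) => [v| |]// mv; rewrite -EFinD lee_fin => vT.
rewrite lee_fin in mv.
apply: (hp_le (y, v)); split; last by rewrite /epigraph/= fyE.
have q0 : 0 <= k * enorm (y - z) ^+ 2 by rewrite mulr_ge0 ?sqr_ge0// ltW.
split => /=; last by rewrite in_itv/= mv/=; lra.
rewrite -ler_sqr ?nnegrE ?enorm_ge0// -(ler_pM2l k0); rewrite /T in vT; lra.
Qed.

(** Compare [p] with the points [t *: y + (1 - t) *: p] of the segment towards
    [y]: convexity of [f] and [sqr_enorm_convex_comb] give the inequality with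
    an extra factor [1 - t] on [enorm (p - y) ^+ 2], and [t] tends to 0. *)
Lemma argmin_prox_three_point k z p y : 0 <= k ->
  argmin (fun x => f x + (k * enorm (x - z) ^+ 2)%:E)%E p ->
  (f p + (k * enorm (p - z) ^+ 2 + k * enorm (p - y) ^+ 2)%:E <=
   f y + (k * enorm (y - z) ^+ 2)%:E)%E.
Proof.
move=> k0 pmin; have [fgt _] := f_proper.
case fyE : (f y) => [b| |]; last 2 first.
- by rewrite addye// leey.
- by have := fgt y; rewrite fyE.
have := pmin y; have := fgt p; rewrite fyE.
case fpE : (f p) => [a| |]// _ _.
rewrite -!EFinD lee_fin.
set P := enorm (p - z) ^+ 2; set Y := enorm (y - z) ^+ 2.
set D := enorm (p - y) ^+ 2.
have D0 : 0 <= k * D by rewrite mulr_ge0 ?sqr_ge0.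
have key (t : R) : 0 < t <= 1 -> a + k * P + (1 - t) * (k * D) <= b + k * Y.
  move=> /andP[t0 t1].
  have t01 : 0 <= t <= 1 by rewrite ltW.
  have /= := pmin (t *: y + (1 - t) *: p).
  have := f_convex y p t01; rewrite fpE fyE -!EFinM -EFinD => fc.
  move=> /le_trans/(_ (leeD2r _ fc)); rewrite -!EFinD lee_fin.
  have -> : t *: y + (1 - t) *: p - z = t *: (y - z) + (1 - t) *: (p - z).
    rewrite !scalerBr addrACA -opprD -scalerDl addrCA subrr addr0.
    by rewrite scale1r.
  rewrite sqr_enorm_convex_comb -/P -/Y.
  rewrite (_ : y - z - (p - z) = y - p); last by rewrite opprB addrA subrK.
  rewrite (enorm_distC y) -/D => H.
  rewrite -(ler_pM2l t0); lra.
apply/ler_addgt0Pl => e e0.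
have ekD : 0 < e + k * D by rewrite ltr_pwDl.
(* This value of t lies in ]0, 1] and satisfies t * (k * D) <= e, so that the
   factor 1 - t loses at most e. *)
have := key (e / (e + k * D)).
rewrite divr_gt0//= ler_pdivrMr// mul1r lerDl D0 => /(_ isT).
suff : e / (e + k * D) * (k * D) <= e by lra.
by rewrite -mulrA ler_piMr ?(ltW e0)// ler_pdivrMl// mulr1; lra.
Qed.

(** One proximal step seen from a minimizer: the squared distance to [s] drops
    by at least the squared displacement plus a multiple of the objective gap.
    All later facts on the proximal map are read off from this inequality. *)
Lemma prox_decrease (alpha m : R) z s : 0 < alpha -> argmin f s ->
    f s = m%:E ->
  exists a : R, [/\ f (prox alpha f z) = a%:E, m <= a &
    2 * alpha * (a - m) + enorm (prox alpha f z - z) ^+ 2 +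
      enorm (prox alpha f z - s) ^+ 2 <= enorm (z - s) ^+ 2].
Proof.
move=> alpha0 sS fsE.
have [fgt _] := f_proper.
have k0 : 0 <= (2 * alpha)^-1 by rewrite invr_ge0 mulr_ge0 ?ltW.
have := @prox_argmin alpha z alpha0 (ex_intro _ s sS).
move=> /(argmin_prox_three_point s k0).
set p := prox _ _ _; have := fgt p; have := sS p; rewrite fsE.
case: (f p) => [a| |]// ma _; rewrite -!EFinD lee_fin => H.
exists a; split => //.
have a20 : 0 < 2 * alpha by rewrite mulr_gt0.
move: H; rewrite (enorm_distC s) -(ler_pM2l a20) !mulrDr !mulrA mulfV ?gt_eqF//.
lra.
Qed.

End ProximalPoint.

(** * Sequences with summable increases *)

Section QuasiMonotone.
Variables (R : realType) (u : nat -> R).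
Hypotheses (u_ge0 : forall k, 0 <= u k).
Hypothesis u_summable : (\sum_(0 <= k <oo) (u k)%:E < +oo)%E.

Lemma summable_bounded : exists E, forall k, \sum_(0 <= i < k) u i <= E.
Proof.
exists (fine (\sum_(0 <= k <oo) (u k)%:E)) => k.
have u0 i : (0 <= (u i)%:E)%E by rewrite lee_fin.
rewrite -lee_fin fineK; last by rewrite ge0_fin_numE// nneseries_ge0.
rewrite -sumEFin; apply: nneseries_lim_ge => i _ _; exact: u0.
Qed.

Lemma summable_tail e : 0 < e ->
  \forall K \near \oo, forall k, \sum_(K <= i < k) u i <= e.
Proof.
move=> e0.
have u0 i : (0 <= (u i)%:E)%E by rewrite lee_fin.
have /fine_cvgP[_ /cvgr0Pnorm_le/(_ e e0)] :=
  nneseries_tail_cvg u_summable (fun i _ => u0 i).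
have /fine_cvgP[+ _] := nneseries_tail_cvg u_summable (fun i _ => u0 i).
apply: filterS2 => K /= fK /(le_trans (ler_norm _)) uK k.
apply: le_trans uK; rewrite -lee_fin fineK//.
rewrite -sumEFin; apply: nneseries_lim_ge => i _ _; exact: u0.
Qed.

Lemma summable_cvg0 : u @ \oo --> 0.
Proof.
apply/cvgr0Pnorm_le => e e0; have := summable_tail e0; apply: filterS => k uk.
by rewrite ger0_norm//; have := uk k.+1; rewrite big_nat1.
Qed.

Variable a : nat -> R.
Hypotheses (a_ge0 : forall k, 0 <= a k).
Hypothesis a_step : forall k, a k.+1 <= a k + u k.

Lemma quasi_decreasing k j : (k <= j)%N -> a j <= a k + \sum_(k <= i < j) u i.
Proof.
elim: j => [|j ih]; first by rewrite leqn0 => /eqP ->; rewrite big_geq ?addr0.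
rewrite leq_eqVlt => /predU1P[<-|kj]; first by rewrite big_geq ?addr0.
rewrite big_nat_recr//= addrA (le_trans (a_step j))// lerD2r; exact: ih.
Qed.

(** Subtracting the partial sums of [u] turns [a] into a nonincreasing sequence
    bounded below; it converges, so its successive differences vanish in the
    limit, and they are the terms below. *)
Lemma quasi_decreasing_gap : a k + u k - a k.+1 @[k --> \oo] --> 0.
Proof.
have [E uE] := summable_bounded.
pose b k := a k - \sum_(0 <= i < k) u i.
have /cvg_ex[l bl] : cvgn b.
  apply: nonincreasing_is_cvgn.
    apply/nonincreasing_seqP => k; rewrite /b big_nat_recr//=.
    by have := a_step k; lra.
  exists (- E) => _ [k _ <-]; rewrite /b.
  by have := uE k; have := a_ge0 k; lra.
have bSl : b k.+1 @[k --> \oo] --> l by have := bl; rewrite -cvg_shiftS.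
rewrite (_ : (fun k => _) = fun k => b k - b k.+1).
  by rewrite -(subrr l); exact: cvgB.
by apply/funext => k; rewrite /b big_nat_recr//=; ring.
Qed.

End QuasiMonotone.

(** * Inexact proximal iterations *)

Section Iterates.
Variables (R : realType) (n : nat) (f : 'rV[R]_n -> \bar R).
Hypotheses (f_proper : proper_fun f) (f_closed : closed_fun f).
Hypothesis f_convex : convex_fun f.
Hypothesis S_nonempty : argmin f !=set0.
Implicit Types (s z : 'rV[R]_n).

Lemma prox_fejer (alpha : R) z s : 0 < alpha -> argmin f s ->
  enorm (prox alpha f z - s) <= enorm (z - s).
Proof.
move=> alpha0 sS; have /fineK/esym fsE := argmin_fin_num f_proper sS.
have [a [_ ma descent]] :=
  prox_decrease f_proper f_closed f_convex z alpha0 sS fsE.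
have a2 : 0 <= 2 * alpha * (a - fine (f s)).
  by rewrite !mulr_ge0 ?subr_ge0// ltW.
rewrite -ler_sqr ?nnegrE ?enorm_ge0//.
have := sqr_ge0 (enorm (prox alpha f z - z)); lra.
Qed.

Lemma prox_displacement (alpha : R) z : 0 < alpha ->
  enorm (prox alpha f z - z) <= dist z (argmin f).
Proof.
move=> alpha0; apply: le_dist => // s sS.
have /fineK/esym fsE := argmin_fin_num f_proper sS.
have [a [_ ma descent]] :=
  prox_decrease f_proper f_closed f_convex z alpha0 sS fsE.
have a2 : 0 <= 2 * alpha * (a - fine (f s)).
  by rewrite !mulr_ge0 ?subr_ge0// ltW.
rewrite -ler_sqr ?nnegrE ?enorm_ge0//.
have := sqr_ge0 (enorm (prox alpha f z - s)); lra.
Qed.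

(** In [prox_decrease] both the objective gap, by the growth hypothesis at [p],
    and [enorm (p - s) ^+ 2] dominate multiples of the squared distance of [p]
    to the solution set; the infimum over [s] is taken last. *)
Lemma prox_dist_contraction (alpha mu : R) z (p := prox alpha f z) :
    0 < alpha -> 0 <= mu ->
    ((mu / 2 * dist p (argmin f) ^+ 2)%:E <= f p - minval f)%E ->
  Num.sqrt (1 + mu * alpha) * dist p (argmin f) <= dist z (argmin f).
Proof.
move=> alpha0 mu0 growth; apply: le_dist => // s sS.
have /fineK/esym fsE := argmin_fin_num f_proper sS.
have [a []] := prox_decrease f_proper f_closed f_convex z alpha0 sS fsE.
rewrite -/p => fpE ma descent.
move: growth; rewrite (minval_argmin sS) fpE fsE -EFinB lee_fin => growth.
have ps : dist p (argmin f) ^+ 2 <= enorm (p - s) ^+ 2.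
  by rewrite ler_sqr ?nnegrE ?enorm_ge0 ?dist_ge0// dist_le.
rewrite -ler_sqr ?nnegrE ?mulr_ge0 ?sqrtr_ge0 ?enorm_ge0 ?dist_ge0//.
rewrite exprMn sqr_sqrtr ?addr_ge0 ?mulr_ge0 ?(ltW alpha0)//.
have := sqr_ge0 (enorm (p - z)).
have : 2 * alpha * (mu / 2 * dist p (argmin f) ^+ 2) <=
  2 * alpha * (a - fine (f s)) by rewrite ler_pM2l ?mulr_gt0.
lra.
Qed.

Variables (c : nat -> R) (c0 : R).
Hypotheses (c0_gt0 : 0 < c0) (c_ge : forall k, c0 <= c k).
Variables (eps : nat -> R) (x : nat -> 'rV[R]_n).
Hypotheses (eps_ge0 : forall k, 0 <= eps k).
Hypothesis eps_summable : (\sum_(0 <= k <oo) (eps k)%:E < +oo)%E.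
Hypothesis x_eps : forall k, enorm (x k.+1 - prox (c k) f (x k)) <= eps k.

Let p k := prox (c k) f (x k).

Let c_gt0 k : 0 < c k. Proof. exact: lt_le_trans (c_ge k). Qed.

Lemma inexact_prox_quasi_fejer s k : argmin f s ->
  enorm (x k.+1 - s) <= enorm (x k - s) + eps k.
Proof.
move=> sS; rewrite (le_trans (enorm_triangle (p k) _ _))// addrC.
by rewrite lerD// prox_fejer.
Qed.

Lemma inexact_prox_bounded s : argmin f s ->
  exists B, forall k, enorm (x k - s) <= B.
Proof.
move=> sS; have [E epsE] := summable_bounded eps_ge0 eps_summable.
exists (enorm (x 0 - s) + E) => k.
have := quasi_decreasing (fun k => inexact_prox_quasi_fejer k sS) (leq0n k).
by have := epsE k; lra.
Qed.

(** The objective gap in [prox_decrease] is controlled by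
    [|x_k - s|^2 - |p_k - s|^2], a product of a bounded sum and of a difference
    that is at most [|x_k - s| + eps_k - |x_{k+1} - s|], which tends to 0. *)
Lemma inexact_prox_value s m : argmin f s -> f s = m%:E ->
  forall e, 0 < e -> \forall k \near \oo, (f (p k) <= (m + e)%:E)%E.
Proof.
move=> sS fsE e e0.
have [B xB] := inexact_prox_bounded sS.
have B0 : 0 <= B by exact: le_trans (enorm_ge0 _) (xB 0).
have := quasi_decreasing_gap eps_ge0 eps_summable
  (fun k => enorm_ge0 (x k - s)) (fun k => inexact_prox_quasi_fejer k sS).
(* B + 1 rather than B keeps the denominator positive. *)
have d0 : 0 < c0 * e / (B + 1) by rewrite divr_gt0 ?mulr_gt0// ltr_pwDr.
move=> /cvgr0Pnorm_le/(_ _ d0); apply: filterS => k /(le_trans (ler_norm _)).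
rewrite ler_pdivlMr ?ltr_pwDr// => gap.
have [v []] :=
  prox_decrease f_proper f_closed f_convex (x k) (c_gt0 k) sS fsE.
rewrite -/(p k) => fpE mv descent.
rewrite fpE lee_fin.
have pa : enorm (p k - s) <= enorm (x k - s) by exact: prox_fejer.
have ap : enorm (x k.+1 - s) <= eps k + enorm (p k - s).
  by rewrite (le_trans (enorm_triangle (p k) _ _))// lerD2r.
have := sqr_ge0 (enorm (p k - x k)) => sq0.
rewrite -lerBlDl -(ler_pM2l c0_gt0).
have h1 : c0 * (v - m) <= c k * (v - m) by rewrite ler_wpM2r ?subr_ge0.
have h2 : (enorm (x k - s) - enorm (p k - s)) *
    (enorm (x k - s) + enorm (p k - s)) <=
    (enorm (x k - s) + eps k - enorm (x k.+1 - s)) * (2 * (B + 1)).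
  have xkB := xB k.
  apply: ler_pM; rewrite ?subr_ge0 ?addr_ge0 ?enorm_ge0//; lra.
have := enorm_ge0 (p k - s); lra.
Qed.

(** Quasi-Fejer monotonicity with respect to the cluster point itself: once some
    [p_k] is close to it and the remaining errors have a small sum, all later
    iterates stay close. *)
Lemma inexact_prox_cvg :
  exists2 xinf, argmin f xinf & enorm (x k - xinf) @[k --> \oo] --> 0.
Proof.
have [s sS] := S_nonempty; have [B xB] := inexact_prox_bounded sS.
have /fineK/esym fsE := argmin_fin_num f_proper sS.
have pB : (p @ \oo) [set y | enorm (y - s) <= B].
  by exists 0%N => // k _ /=; apply: le_trans (xB k); exact: prox_fejer.
have [xinf [_ xinfP]] := compact_enorm_ball _ pB.
have xinfS : argmin f xinf.
  move=> y; apply: le_trans (sS y); rewrite fsE.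
  apply/lee_addgt0Pr => e e0; rewrite -EFinD.
  apply: (sublevel_closed f_closed) => U xinfU.
  by apply: xinfP => //; exact: inexact_prox_value sS fsE _ e0.
exists xinf => //; apply/cvgr0Pnorm_le => e e0.
have e20 : 0 < e / 2 by rewrite divr_gt0.
have [K _ tailK] := summable_tail eps_ge0 eps_summable e20.
have xinf_nbhs : nbhs xinf [set y | enorm (y - xinf) < e / 2].
  have := @enormB_continuous _ _ xinf xinf.
  by move=> /cvgr_lt; apply; rewrite subrr enorm0.
have pK : (p @ \oo) (p @` [set k | (K <= k)%N]).
  by exists K => // k Kk; exists k.
have [_ [[k /= Kk <-] pke]] := xinfP _ _ pK xinf_nbhs.
exists k.+1 => // j /= kj; rewrite ger0_norm ?enorm_ge0//.
have := quasi_decreasing (fun k => inexact_prox_quasi_fejer k xinfS) kj.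
have := enorm_triangle (p k) (x k.+1) xinf; have := x_eps k.
have := tailK k Kk j; rewrite big_ltn//.
rewrite /= in pke; rewrite -/(p k); lra.
Qed.

End Iterates.

(** * Linear convergence of the distance to the solution set *)

Theorem theorem5p3 (R : realType) (n : nat) (f : 'rV[R]_n -> \bar R)
  (f_proper : proper_fun f) (f_closed : closed_fun f) (f_convex : convex_fun f)
  (S_nonempty : argmin f !=set0)
  (quadratic_growth : forall xstar : 'rV[R]_n, argmin f xstar ->
     exists (mu : R) (U : set 'rV[R]_n),
       [/\ 0 < mu, nbhs xstar U &
         forall x, U x ->
           ((mu / 2 * dist x (argmin f) ^+ 2)%:E <= f x - minval f)%E])
  (c : nat -> R) (c_gt0 : forall k, 0 < c k)
  (c_bounded_away : exists2 c0 : R, 0 < c0 & forall k, c0 <= c k)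
  (eps delta : nat -> R)
  (eps_ge0 : forall k, 0 <= eps k) (delta_ge0 : forall k, 0 <= delta k)
  (eps_summable : (\sum_(0 <= k <oo) (eps k)%:E < +oo)%E)
  (delta_summable : (\sum_(0 <= k <oo) (delta k)%:E < +oo)%E)
  (x : nat -> 'rV[R]_n)
  (x_eps : forall k, enorm (x k.+1 - prox (c k) f (x k)) <= eps k)
  (x_delta : forall k,
     enorm (x k.+1 - prox (c k) f (x k)) <= delta k * enorm (x k.+1 - x k)) :
  exists (theta : nat -> R) (kbar : nat),
    [/\ forall k, 0 <= theta k < 1,
        (0 < kbar)%N &
        forall k, (kbar <= k)%N ->
          let theta_hat := (theta k + 2 * delta k) / (1 - delta k) in
          [/\ delta k < 1,
              theta_hat < 1 &
              dist (x k.+1) (argmin f) <= theta_hat * dist (x k) (argmin f)]].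
Proof.
have [c0 c0_gt0 c_ge] := c_bounded_away.
have [xinf xinfS x_cvg] := inexact_prox_cvg f_proper f_closed f_convex
  S_nonempty c0_gt0 c_ge eps_ge0 eps_summable x_eps.
have [mu [U [mu0 xinfU growth]]] := quadratic_growth _ xinfS.
have muc0 : 0 < mu * c0 by rewrite mulr_gt0.
have sq1 : 1 < Num.sqrt (1 + mu * c0).
  by rewrite -(ltr_sqr)?nnegrE ?sqrtr_ge0// sqr_sqrtr ?addr_ge0 ?(ltW muc0)//; lra.
have sq0 : 0 < Num.sqrt (1 + mu * c0) by exact: lt_trans sq1.
pose th := (Num.sqrt (1 + mu * c0))^-1.
have th0 : 0 <= th by rewrite invr_ge0 ltW.
have th1 : th < 1 by rewrite invf_lt1.
have [r r0 rU] : exists2 r : R, 0 < r & ball xinf r `<=` U.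
  by have /nbhs_ballP[r r0 rU] := xinfU; exists r.
(* Any bound on delta below (1 - th) / 3 makes theta_hat < 1. *)
have dlt : 0 < (1 - th) / 4 by rewrite divr_gt0 ?subr_gt0.
have [K _ KP] : \forall k \near \oo,
    enorm (x k - xinf) < r /\ delta k < (1 - th) / 4.
  near=> k; split; near: k; first exact: cvgr_lt x_cvg _ r0.
  exact: cvgr_lt (summable_cvg0 delta_ge0 delta_summable) _ dlt.
exists (fun=> th), K.+1; split => // [k|k Kk /=]; first by rewrite th0.
have [xr dk] := KP k (ltnW Kk).
have d1 : delta k < 1 by lra.
have d1' : 0 < 1 - delta k by rewrite subr_gt0.
split => //; first by rewrite ltr_pdivrMr// mul1r; lra.
set p := prox (c k) f (x k).
have pU : U p.
  apply: rU; rewrite -ball_normE /ball_/= distrC.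
  rewrite (le_lt_trans (norm_le_enorm _))// (le_lt_trans _ xr)//.
  exact: prox_fejer.
have pdist : dist p (argmin f) <= th * dist (x k) (argmin f).
  rewrite ler_pdivlMl//; apply: le_trans (prox_dist_contraction f_proper
    f_closed f_convex S_nonempty (c_gt0 k) (ltW mu0) (growth _ pU)).
  rewrite ler_wpM2r ?dist_ge0// ler_wsqrtr// lerD2l.
  by rewrite ler_wpM2l// ltW.
have disp : enorm (p - x k) <= dist (x k) (argmin f) by exact: prox_displacement.
have step := dist_triangle (x k.+1) p S_nonempty.
have move_le := enorm_triangle p (x k.+1) (x k).
have := x_delta k; rewrite -/p => xd.
have d0 := delta_ge0 k; have D0 := dist_ge0 (x k) S_nonempty.
rewrite mulrAC ler_pdivlMr//.
set D := dist (x k) _ in pdist disp D0 *.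
have steplen : (1 - delta k) * enorm (x k.+1 - x k) <= D by lra.
have : (1 - delta k) * (delta k * enorm (x k.+1 - x k)) <= delta k * D.
  by rewrite mulrCA ler_wpM2l.
have : (1 - delta k) * dist (x k.+1) (argmin f) <=
    (1 - delta k) * (delta k * enorm (x k.+1 - x k) + th * D).
  by rewrite ler_wpM2l ?(ltW d1')//; lra.
have : 0 <= delta k * th * D by rewrite !mulr_ge0.
have : 0 <= delta k * D by rewrite !mulr_ge0.
lra.
Unshelve. all: by end_near.
Qed.
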